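(* Let $(\mathcal{N},\mathcal{I})$ be a $k$-system of rank $r$ on a ground set of size $n$, $f$ non-negative submodular, and let the USM subroutine be deterministic, use $O(n)$ oracle calls, and be an $\alpha$-approximation. Run RepeatedGreedy with $\ell=\lfloor1+\sqrt{2(k+1)/\alpha}\rfloor$. Then RepeatedGreedy makes $O(\sqrt{k}\,rn)$ oracle calls and produces an independent set whose approximation ratio is at most $k+\sqrt{2\alpha}\sqrt{k}+(\alpha+1)+o(1)$ (with $o(1)$ a term vanishing as $k\to\infty$). Moreover, when $f$ is non-negative monotone submodular and $\ell=1$, the approximation ratio of RepeatedGreedy is at most $k+1$.
   Context: $\mathcal{N}$ finite, $|\mathcal{N}|=n$; $f$ submodular: $f(X\cup Y)+f(X\cap Y)\le f(X)+f(Y)$; monotone: $f(A)\le f(B)$ for $A\subseteq B$; $f(u\mid S)=f(S\cup\{u\})-f(S)$; $S+u=S\cup\{u\}$. Independence system: non-empty down-closed $\mathcal{I}\subseteq2^{\mathcal{N}}$; base of $B$: maximal independent subset of $B$; $k$-system: for every $B$ any two bases of $B$ have size ratio at most $k$; rank $r$: max size of an independent set. $OPT$ maximizes $f$ over $\mathcal{I}$; ratio at most $\alpha'$ means $f(S)\ge f(OPT)/\alpha'$. Oracle calls: value oracle for $f$ and independence oracle for $\mathcal{I}$. Greedy$(\mathcal{N}',f,\mathcal{I})$: $S=\varnothing$; while some $u\in\mathcal{N}'\setminus S$ has $S+u\in\mathcal{I}$ and $f(u\mid S)>0$, add such $u$ maximizing $f(u\mid S)$; return $S$. USM$(A,f)$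 (unconstrained submodular maximization) returns $X\subseteq A$ with $f(X)\ge\frac1\alpha f(B)$ for all $B\subseteq A$. RepeatedGreedy$(\mathcal{N},f,\mathcal{I},\ell)$: $\mathcal{N}_1=\mathcal{N}$; for $i=1,\dots,\ell$: $S_i=$Greedy$(\mathcal{N}_i,f,\mathcal{I})$, $S_i'=$USM$(S_i,f)$, $\mathcal{N}_{i+1}=\mathcal{N}_i\setminus S_i$. Return the set maximizing $f$ among $S_1,S_1',\dots,S_\ell,S_\ell'$. *)

(* Defs.v *)
From mathcomp Require Import all_boot all_order all_algebra.
From mathcomp Require Import all_classical all_reals all_analysis.

Set Implicit Arguments.
Unset Strict Implicit.
Unset Printing Implicit Defensive.

Import Order.TTheory GRing.Theory Num.Theory.
Import numFieldNormedType.Exports.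

Local Open Scope ring_scope.

Definition nonneg_setfun (R : realType) (N : finType)
    (f : {set N} -> R) : Prop :=
  forall X, 0 <= f X.

Definition submodular_setfun (R : realType) (N : finType)
    (f : {set N} -> R) : Prop :=
  forall X Y, f (X :|: Y) + f (X :&: Y) <= f X + f Y.

Definition monotone_setfun (R : realType) (N : finType)
    (f : {set N} -> R) : Prop :=
  forall A B : {set N}, A \subset B -> f A <= f B.

Definition independence_system (N : finType) (I : {set {set N}}) : Prop :=
  I != finset.set0 /\
  forall A B : {set N}, A \subset B -> B \in I -> A \in I.

Definition base_of (N : finType) (I : {set {set N}}) (B X : {set N}) : bool :=
  maxset (fun Y : {set N} => (Y \in I) && (Y \subset B)) X.

(* The ratio #|X| / #|Y| <= k in multiplied-out form, so that an empty base
   needs no convention for division by zero. *)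
Definition k_system (R : realType) (N : finType) (k : R) (I : {set {set N}}) :
    Prop :=
  independence_system I /\
  forall B X Y : {set N}, base_of I B X -> base_of I B Y ->
    #|X|%:R <= k * #|Y|%:R.

Definition rank (N : finType) (I : {set {set N}}) : nat :=
  (\max_(S in I) #|S|)%N.

Definition is_OPT (R : realType) (N : finType) (f : {set N} -> R)
    (I : {set {set N}}) (O : {set N}) : Prop :=
  O \in I /\ forall T : {set N}, T \in I -> f T <= f O.

(* Positivity of a is required because division by 0 is total. *)
Definition approx_ratio_at_most (R : realType) (N : finType)
    (f : {set N} -> R) (I : {set {set N}}) (S : {set N}) (a : R) : Prop :=
  0 < a /\ forall O, is_OPT f I O -> f O / a <= f S.

(* Deterministic oracle algorithms: an algorithm either stops or asks a query
   and continues with the answer.  Everything between two queries is free, so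
   that the length of the executed branch is the number of oracle calls. *)
Inductive prog (Q : Type) (Ans : Q -> Type) (T : Type) : Type :=
| Ret (x : T)
| Ask (q : Q) (next : Ans q -> prog Ans T).
Arguments Ret {Q Ans T} x.
Arguments Ask {Q Ans T} q next.

Fixpoint bind (Q : Type) (Ans : Q -> Type) (T U : Type)
    (p : prog Ans T) (g : T -> prog Ans U) : prog Ans U :=
  match p with
  | Ret x => g x
  | Ask q next => Ask q (fun a => bind (next a) g)
  end.

Fixpoint result (Q : Type) (Ans : Q -> Type) (T : Type)
    (o : forall q, Ans q) (p : prog Ans T) : T :=
  match p with
  | Ret x => x
  | Ask q next => result o (next (o q))
  end.

Fixpoint calls (Q : Type) (Ans : Q -> Type) (T : Type)
    (o : forall q, Ans q) (p : prog Ans T) : nat :=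
  match p with
  | Ret _ => 0%N
  | Ask q next => (calls o (next (o q))).+1
  end.

Definition value_prog (R : realType) (N : finType) (T : Type) : Type :=
  @prog {set N} (fun _ => R) T.

Inductive query (N : finType) : Type :=
| Value (S : {set N})
| Indep (S : {set N}).

Definition answer (R : realType) (N : finType) (q : query N) : Type :=
  match q with Value _ => R | Indep _ => bool end.

Definition oracles (R : realType) (N : finType) (f : {set N} -> R)
    (I : {set {set N}}) (q : query N) : answer R q :=
  match q with Value X => f X | Indep X => X \in I end.

Definition oracle_prog (R : realType) (N : finType) (T : Type) : Type :=
  @prog (query N) (@answer R N) T.

Definition ask_value (R : realType) (N : finType) (S : {set N}) :
    oracle_prog R N R :=
  @Ask _ (@answer R N) R (Value S) (fun v => Ret v).

Definition ask_indep (R : realType) (N : finType) (S : {set N}) :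
    oracle_prog R N bool :=
  @Ask _ (@answer R N) bool (Indep S) (fun b => Ret b).

Fixpoint lift_value (R : realType) (N : finType) (T : Type)
    (p : value_prog R N T) : oracle_prog R N T :=
  match p with
  | Ret x => Ret x
  | Ask X next =>
      @Ask _ (@answer R N) T (Value X) (fun v => lift_value (next v))
  end.

(* Tie breaking among the members of the nonempty list x :: s. *)
Record tie_rule (T : eqType) : Type := TieRule {
  tie_pick :> T -> seq T -> T;
  tie_pickP : forall x s, tie_pick x s \in x :: s
}.

Definition argmaxes (R : realType) (T : eqType) (s : seq (T * R)) : seq T :=
  [seq p.1 | p <- s & all (fun q => q.2 <= p.2) s].

(* The pairs (u, f(u | S)) for those u in us with S + u independent, where
   fS is the value of f at S. *)
Fixpoint feasible_marginals (R : realType) (N : finType) (S : {set N}) (fS : R)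
    (us : seq N) : oracle_prog R N (seq (N * R)) :=
  match us with
  | [::] => Ret [::]
  | u :: us' =>
      bind (ask_indep R (u |: S)%SET) (fun b : bool =>
      if b then
        bind (ask_value R (u |: S)%SET) (fun v : R =>
        bind (feasible_marginals S fS us') (fun ps =>
        Ret ((u, v - fS) :: ps)))
      else feasible_marginals S fS us')
  end.

(* The tie-breaking rule may depend on the ground set N' of this execution and
   on the current solution S.  Since (N', S) never recurs at an addition within
   one run of repeated_greedy, letting the rule vary covers every way of
   resolving ties. *)
Fixpoint greedy_loop (R : realType) (N : finType)
    (tie : {set N} -> {set N} -> tie_rule N) (N' : {set N}) (fuel : nat)
    (S : {set N}) : oracle_prog R N {set N} :=
  match fuel with
  | 0%N => Ret S
  | fuel'.+1 =>
      bind (ask_value R S) (fun fS : R =>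
      bind (feasible_marginals S fS (enum (N' :\: S)%SET)) (fun ps =>
      match argmaxes [seq p <- ps | 0 < p.2] with
      | [::] => Ret S
      | u :: us => greedy_loop R tie N' fuel' (tie N' S u us |: S)%SET
      end))
  end.

(* After #|N'| additions nothing is left to add, so this fuel never interrupts
   the loop. *)
Definition greedy (R : realType) (N : finType)
    (tie : {set N} -> {set N} -> tie_rule N) (N' : {set N}) :
    oracle_prog R N {set N} :=
  greedy_loop R tie N' #|N'| finset.set0.

Definition usm_algorithm (R : realType) : Type :=
  forall N : finType, {set N} -> value_prog R N {set N}.

Definition usm_approximation (R : realType) (alpha : R)
    (usm : usm_algorithm R) : Prop :=
  forall (N : finType) (f : {set N} -> R) (A : {set N}),
    nonneg_setfun f -> submodular_setfun f ->
    result f (usm N A) \subset A /\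
    forall B : {set N}, B \subset A ->
      alpha^-1 * f B <= f (result f (usm N A)).

Definition usm_linear_calls (R : realType) (usm : usm_algorithm R) : Prop :=
  exists c : R, forall (N : finType) (f : {set N} -> R) (A : {set N}),
    nonneg_setfun f -> submodular_setfun f -> (0 < #|N|)%N ->
    (calls f (usm N A))%:R <= c * #|N|%:R.

(* The sets S_1, S'_1, ..., S_l, S'_l. *)
Fixpoint candidates (R : realType) (N : finType) (usm : usm_algorithm R)
    (tie : {set N} -> {set N} -> tie_rule N) (l : nat) (Ni : {set N}) :
    oracle_prog R N (seq {set N}) :=
  match l with
  | 0%N => Ret [::]
  | l'.+1 =>
      bind (greedy R tie Ni) (fun S =>
      bind (lift_value (usm N S)) (fun S' =>
      bind (candidates usm tie l' (Ni :\: S)%SET) (fun Ss =>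
      Ret (S :: S' :: Ss))))
  end.

Fixpoint with_values (R : realType) (N : finType) (Ss : seq {set N}) :
    oracle_prog R N (seq ({set N} * R)) :=
  match Ss with
  | [::] => Ret [::]
  | X :: Ss' =>
      bind (ask_value R X) (fun v : R =>
      bind (with_values R Ss') (fun ps => Ret ((X, v) :: ps)))
  end.

(* The empty list of maximizers only arises for l = 0. *)
Definition repeated_greedy (R : realType) (N : finType)
    (usm : usm_algorithm R) (tie : {set N} -> {set N} -> tie_rule N)
    (out : tie_rule {set N}) (l : nat) : oracle_prog R N {set N} :=
  bind (candidates usm tie l [set: N]%SET) (fun Ss =>
  bind (with_values R Ss) (fun ps =>
  match argmaxes ps with
  | [::] => Ret finset.set0
  | X :: Ss' => Ret (out X Ss')
  end)).

(* truncn is the floor on nonnegative reals.  The value is at least 2 exactly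
   when alpha <= 2 (k + 1), hence for all large k. *)
Definition ell (R : realType) (alpha k : R) : nat :=
  Num.truncn (1 + Num.sqrt (2 * (k + 1) / alpha)).

(* Main.v *)
(* A greedy solution [S] on a ground set [A] satisfies
   [f (S :|: C) <= (k + 1) * f S] for every independent [C \subset A]: after [i]
   additions at most [k * i] elements of [C] are blocked, and each of them has
   marginal at most that of the addition that blocked it, so Abel summation
   bounds their total gain by [k * f S].
   Let [S_1, ..., S_l] be the greedy solutions and [O] an optimum.  The [S_i] are
   disjoint, hence [(l - 1) * f O <= \sum_i f (S_i :|: O)].  The part of [O]
   still available in round [i] is covered by the greedy bound, and the part
   lying in [S_j], [j < i], is worth at most [alpha * f S'_j].  With [M] the best
   value found, [(l - 1) * f O <= (l * (k + 1) + alpha * l * (l - 1) / 2) * M],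
   and the chosen [l] essentially minimizes the resulting ratio. *)

Require Import Defs.
From mathcomp Require Import all_boot all_order all_algebra.
From mathcomp Require Import all_classical all_reals all_analysis.
From mathcomp Require Import ring lra zify.
Import Order.TTheory GRing.Theory Num.Theory.
Import numFieldNormedType.Exports.
Local Open Scope ring_scope.
Local Open Scope classical_set_scope.

(** * Semantics and cost of query programs, and maximizers of finite lists *)

Lemma result_bind {Q : Type} {Ans : Q -> Type} {T U : Type}
    (o : forall q, Ans q) (p : prog Ans T) (g : T -> prog Ans U) :
  result o (bind p g) = result o (g (result o p)).
Proof. by elim: p => //= q next IH; rewrite IH. Qed.

Lemma calls_bind {Q : Type} {Ans : Q -> Type} {T U : Type}
    (o : forall q, Ans q) (p : prog Ans T) (g : T -> prog Ans U) :
  calls o (bind p g) = (calls o p + calls o (g (result o p)))%N.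
Proof. by elim: p => //= q next IH; rewrite IH addSn. Qed.

Lemma mem_argmaxes {R : realType} {T : eqType} (s : seq (T * R)) (x : T) :
  x \in argmaxes s ->
  exists v, (x, v) \in s /\ forall q, q \in s -> q.2 <= v.
Proof.
move=> /mapP[[y v]]; rewrite mem_filter /= => /andP[/allP hall ys] ->.
by exists v.
Qed.

(** A nonempty finite list attains its maximum. Hence greedy stops only when no feasible element has
    positive marginal. *)
Lemma argmaxes_eq0 {R : realType} {T : eqType} (s : seq (T * R)) :
  argmaxes s = [::] -> s = [::].
Proof.
move=> s0; apply: contraPP s0 => s0.
have [p ps pmax] : exists2 p, p \in s & forall q, q \in s -> q.2 <= p.2.
  elim: s s0 => // a [_ _|b s IH _].
    by exists a; rewrite ?mem_head // => q; rewrite inE => /eqP ->.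
  have [//|p ps pmax] := IH.
  have [le_ap|lt_pa] := leP a.2 p.2.
    exists p => [|q]; first by rewrite inE ps orbT.
    by rewrite inE => /predU1P[->|/pmax].
  exists a => [|q]; first exact: mem_head.
  by rewrite inE => /predU1P[->//|/pmax /le_trans]; apply; exact: ltW.
move=> /(congr1 (fun t => p.1 \in t)); rewrite in_nil.
suff -> : p.1 \in argmaxes s by [].
by apply/mapP; exists p; rewrite // mem_filter ps andbT; apply/allP.
Qed.

(** * Outcomes and query counts of the subroutines *)

Section Oracles.
Import boot.fintype boot.finset.
Variables (R : realType) (N : finType) (I : {set {set N}}) (f : {set N} -> R).
Implicit Types (S T A B C W : {set N}) (u : N) (us : seq N).
Let o := oracles f I.

Lemma result_lift_value U (p : value_prog R N U) :
  result o (lift_value p) = result f p.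
Proof. by elim: p => //= q next IH; rewrite IH. Qed.

Lemma calls_lift_value U (p : value_prog R N U) :
  calls o (lift_value p) = calls f p.
Proof. by elim: p => //= q next IH; rewrite IH. Qed.

Lemma result_feasible_marginals S v us :
  result o (feasible_marginals S v us) =
  [seq (u, f (u |: S)%SET - v) | u <- us & (u |: S)%SET \in I].
Proof.
elim: us => //= u us IH; case: ifP => _ //=.
by rewrite result_bind IH.
Qed.

Lemma calls_feasible_marginals S v us :
  (calls o (feasible_marginals S v us) <= 2 * size us)%N.
Proof.
elim: us => //= u us IH; case: ifP => _ /=; last by lia.
by rewrite calls_bind /=; lia.
Qed.

Lemma result_with_values (Ss : seq {set N}) :
  result o (with_values R Ss) = [seq (X, f X) | X <- Ss].
Proof. by elim: Ss => //= X Ss IH; rewrite result_bind IH. Qed.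

Lemma calls_with_values (Ss : seq {set N}) :
  calls o (with_values R Ss) = size Ss.
Proof. by elim: Ss => //= X Ss IH; rewrite calls_bind IH /= addn0. Qed.

(** * A single greedy run: its steps, output and query count *)

Section Greedy.
Variable (tie : {set N} -> {set N} -> tie_rule N).

(** One iteration either stops or adds a best element. Its cost is one value query at [S] and at
    most two queries per remaining element. *)
Lemma greedy_loopS_spec A fuel S :
  (result o (greedy_loop R tie A fuel.+1 S) = S /\
   (forall u, u \in (A :\: S)%SET -> (u |: S)%SET \in I ->
     f (u |: S)%SET - f S <= 0) /\
   (calls o (greedy_loop R tie A fuel.+1 S) <= 1 + 2 * #|N|)%N) \/
  exists u, [/\ u \in (A :\: S)%SET, (u |: S)%SET \in I,
    0 < f (u |: S)%SET - f S,
    (forall v, v \in (A :\: S)%SET -> (v |: S)%SET \in I ->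
       f (v |: S)%SET - f S <= f (u |: S)%SET - f S) &
    result o (greedy_loop R tie A fuel.+1 S) =
      result o (greedy_loop R tie A fuel (u |: S)%SET) /\
    (calls o (greedy_loop R tie A fuel.+1 S) <=
      1 + 2 * #|N| + calls o (greedy_loop R tie A fuel (u |: S)%SET))%N].
Proof.
rewrite /= result_bind calls_bind result_feasible_marginals.
have := calls_feasible_marginals S (f S) (enum (A :\: S)%SET).
rewrite -cardE => hc0.
have := leq_trans hc0 (leq_mul (leqnn 2) (max_card (mem (A :\: S)%SET))).
move: {hc0}(calls _ _) => c hc; set ps := map _ _.
have psP v : v \in (A :\: S)%SET -> (v |: S)%SET \in I ->
    (v, f (v |: S)%SET - f S) \in ps.
  by move=> vAS vI; apply: map_f; rewrite mem_filter vI mem_enum.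
case E: argmaxes => [|u us].
  left; split; [by []|split; last by rewrite addn0 add1n ltnS].
  move=> v vAS vI; rewrite leNgt; apply/negP => v0.
  have := argmaxes_eq0 _ E.
  move=> /(congr1 (fun t => (v, f (v |: S)%SET - f S) \in t)).
  by rewrite mem_filter /= v0 psP.
right; set w := tie A S u us; exists w.
have : w \in argmaxes [seq p <- ps | 0 < p.2].
  by rewrite E; exact: tie_pickP.
move=> /mem_argmaxes[v []]; rewrite mem_filter /= => /andP[v0].
move=> /mapP[w' + [ew ev]]; rewrite -ew mem_filter mem_enum.
move=> /andP[wI wAS] vmax.
rewrite {}ev -{}ew in v0 vmax.
split => //; last by split => //; rewrite add1n addSn ltnS leq_add2r.
move=> z zAS zI.
(* Elements of nonpositive marginal are filtered out before the maximum is taken; for them the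
   positive marginal of [w] settles the comparison. *)
have [z0|z0] := ltP 0 (f (z |: S)%SET - f S); last exact: le_trans (ltW v0).
by have := vmax (z, f (z |: S)%SET - f S); apply; rewrite mem_filter /= z0 psP.
Qed.

Lemma greedy_loop_result A fuel S : S \in I -> S \subset A ->
  let T := result o (greedy_loop R tie A fuel S) in
  [/\ T \in I, S \subset T & T \subset A].
Proof.
elim: fuel S => [|fuel IH] S SI SA; first by [].
have [[-> _]|[u [uAS uI _ _ [-> _]]]] := greedy_loopS_spec A fuel S; first by [].
have uSA : (u |: S)%SET \subset A.
  by rewrite subUset SA sub1set andbT; case/setDP: uAS.
have [TI uST TA] := IH _ uI uSA.
by split => //; exact: subset_trans (subsetUr _ _) uST.
Qed.

Lemma card_le_rank S : S \in I -> (#|S| <= rank I)%N.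
Proof. by move=> SI; exact: (@leq_bigmax_cond _ (mem I) (fun X => #|X|)). Qed.

(** Every addition enlarges an independent set, so at most [rank I - #|S|] additions occur; the
    extra iteration is the one that finds nothing to add. *)
Lemma greedy_loop_calls A fuel S : S \in I ->
  (calls o (greedy_loop R tie A fuel S) <=
     (rank I - #|S| + 1) * (1 + 2 * #|N|))%N.
Proof.
elim: fuel S => [|fuel IH] S SI; first by [].
have [[_ [_ /leq_trans]]|[u [uAS uI _ _ [_ /leq_trans]]]] :=
  greedy_loopS_spec A fuel S; apply; first by nia.
apply: leq_trans (leq_add (leqnn _) (IH _ uI)) _.
have := card_le_rank _ uI; rewrite cardsU1.
by case/setDP: uAS => _ -> /=; nia.
Qed.


(** * Approximation guarantee of greedy on a k-system *)

Section Approximation.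
Variable k : R.
Hypotheses (k_ge1 : 1 <= k) (sysI : k_system k I).
Hypotheses (f_ge0 : nonneg_setfun f) (f_sub : submodular_setfun f).

Lemma k_system_set0 : finset.set0 \in I.
Proof.
have [[/set0Pn[X XI] down] _] := sysI.
exact: down (sub0set X) XI.
Qed.

(** Diminishing returns: submodularity for [u |: S] and [T], which meet exactly in [S]. *)
Lemma submodular_marginal S T u : S \subset T -> u \notin T ->
  f (u |: T)%SET - f T <= f (u |: S)%SET - f S.
Proof.
move=> ST uT; have := f_sub (u |: S)%SET T.
have -> : ((u |: S) :|: T)%SET = (u |: T)%SET by rewrite -setUA (setUidPr ST).
have -> : ((u |: S) :&: T)%SET = S.
  rewrite setIUl (setIidPl ST) (_ : ([set u] :&: T)%SET = finset.set0) ?set0U //.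
  by apply/setP => x; rewrite !inE; case: eqP => // ->; exact: negbTE.
lra.
Qed.

Lemma submodular_sum_marginals T C :
  f (T :|: C)%SET - f T <= \sum_(u in C) (f (u |: T)%SET - f T).
Proof.
move En : #|C| => n; elim: n C En => [|n IH] C.
  by move=> /eqP; rewrite cards_eq0 => /eqP ->; rewrite setU0 subrr big_set0.
move=> Cn; have [x xC] : exists x, x \in C.
  by apply/set0Pn; rewrite -cards_eq0 Cn.
have := IH (C :\ x)%SET; rewrite (cardsD1 x) xC in Cn.
case: Cn => Cn /(_ Cn); rewrite (big_setD1 x xC) /= => le1.
(* One element [x] is peeled off [C]; the two sets meet in [T] even when [x] lies in [T]. *)
have := f_sub (T :|: C :\ x)%SET (x |: T)%SET.
have -> : ((T :|: C :\ x) :|: (x |: T))%SET = (T :|: C)%SET.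
  apply/setP => y; rewrite !inE; case: eqP => [->|_] /=; last first.
    by case: (y \in T); rewrite ?orbF.
  by rewrite xC !orbT.
have -> : ((T :|: C :\ x) :&: (x |: T))%SET = T.
  by apply/setP => y; rewrite !inE; case: eqP; case: (y \in T); rewrite ?andbF ?andbT.
lra.
Qed.

(* [S] is a base of [S] together with the elements of [C] that it blocks, so
   the k-system property bounds the number of these elements. *)
Lemma blocked_sum_le C S (d : R) : C \in I -> S \in I -> 0 <= d ->
  \sum_(u in C) (if (u |: S)%SET \in I then 0 else d) <= k * #|S|%:R * d.
Proof.
move=> CI SI d0; have [[_ down] kI] := sysI.
pose D := [set u in C | (u |: S)%SET \notin I]%SET.
rewrite (eq_bigr (fun u => if (u |: S)%SET \notin I then d else 0)); last first.
  by move=> u _; case: ifP.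
rewrite -big_mkcondr /= (eq_bigl (fun u => u \in D)); last first.
  by move=> u; rewrite inE.
rewrite sumr_const -(mulr_natl d).
apply: ler_wpM2r => //.
have SB : base_of I (S :|: D)%SET S.
  apply/maxsetP; split => [|Y /andP[YI YB] SY]; first by rewrite SI subsetUl.
  apply/eqP; rewrite eqEsubset SY andbT; apply/subsetP => u uY.
  have := subsetP YB _ uY; rewrite inE => /orP[//|]; rewrite inE => /andP[_ /negP].
  by case; apply: down YI; rewrite subUset sub1set uY.
have DI : D \in I by apply: down CI; apply/subsetP => u; rewrite inE => /andP[].
have [|X XB DX] := @maxset_exists _
  (fun Y : {set N} => (Y \in I) && (Y \subset S :|: D)%SET) D.
  by rewrite DI subsetUr.
apply: le_trans (kI _ _ _ XB SB).
by rewrite ler_nat subset_leq_card.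
Qed.

(* Each element of [C] that is blocked at some point is charged the marginal of
   the element whose addition blocked it.  Summands already blocked by [S] carry
   the current bound [d] on marginals, so that lowering [d] along the run is
   Abel summation of the charges. *)
Lemma greedy_loop_gain C A fuel S (d : R) :
  C \in I -> C \subset A -> S \in I -> S \subset A ->
  (#|A| <= fuel + #|S|)%N -> 0 <= d ->
  (forall u, u \in (A :\: S)%SET -> (u |: S)%SET \in I ->
    f (u |: S)%SET - f S <= d) ->
  let T := result o (greedy_loop R tie A fuel S) in
  \sum_(u in C) (if (u |: S)%SET \in I then f (u |: T)%SET - f T else d) <=
    k * (f T - f S) + k * #|S|%:R * d.
Proof.
move=> CI CA.
(* Both ways the run can end: unblocked elements contribute at most 0, blocked ones at most [d']
   each. *)
have stuck S' (d' : R) : S' \in I -> 0 <= d' ->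
    (forall u, u \in C -> (u |: S')%SET \in I -> f (u |: S')%SET - f S' <= 0) ->
    \sum_(u in C) (if (u |: S')%SET \in I then f (u |: S')%SET - f S' else d') <=
    k * (f S' - f S') + k * #|S'|%:R * d'.
  move=> SI d0 le0; rewrite subrr mulr0 add0r.
  apply: le_trans (blocked_sum_le C S' d' CI SI d0).
  by apply: ler_sum => u uC; case: ifP => // /(le0 _ uC).
have inS S' u : u \in S' -> f (u |: S')%SET - f S' = 0.
  by move=> uS; rewrite (setUidPr _) ?sub1set // subrr.
elim: fuel S d => [|fuel IH] S d SI SA fuelS d0 dP.
  (* Without fuel, the invariant [#|A| <= fuel + #|S|] leaves nothing of [A] outside [S]. *)
  have SeA : S = A by apply/eqP; rewrite eqEcard SA.
  by apply: stuck => // u uC _; rewrite inS // SeA (subsetP CA).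
have [[-> [le0 _]]|[w [wAS wI w0 wmax [-> _]]]] := greedy_loopS_spec A fuel S.
  apply: stuck => // u uC uI; case uS: (u \in S); first by rewrite inS.
  by apply: le0; rewrite // inE uS (subsetP CA).
have [_ down] := sysI.1.
have [wA wS] := setDP wAS.
set d' := f (w |: S)%SET - f S in w0 wmax.
have wSA : (w |: S)%SET \subset A by rewrite subUset SA sub1set wA.
have := IH (w |: S)%SET d' wI wSA; rewrite cardsU1 wS /=.
have [_ + _] := greedy_loop_result A fuel _ wI wSA.
set T := result _ _ => wST.
have ST : S \subset T by apply: subset_trans wST; exact: subsetUr.
move=> {}IH; have fuelS1 : (#|A| <= fuel + (1 + #|S|))%N.
  by rewrite add1n addnS -addSn.
have {}IH := IH fuelS1 (ltW w0).
have {IH}/IH : forall u, u \in (A :\: (w |: S))%SET ->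
    (u |: (w |: S))%SET \in I -> f (u |: (w |: S))%SET - f (w |: S)%SET <= d'.
  move=> u uAwS uI; have [uA uwS] := setDP uAwS.
  apply: le_trans (submodular_marginal S (w |: S)%SET u (subsetUr _ _) uwS) _.
  apply: wmax; last by apply: down uI; apply: setUS; exact: subsetUr.
  by rewrite inE uA andbT; apply: contra uwS => uS; rewrite inE uS orbT.
set F' := \sum_(u in C) _ => F'le.
(* [F] lowers the charge to [d'] but keeps blocking relative to [S]. An element blocked only by
   adding [w] has marginal over [T] at most [d'], by diminishing returns and the choice of [w];
   hence [F <= F']. *)
pose F := \sum_(u in C) (if (u |: S)%SET \in I then f (u |: T)%SET - f T else d').
have FF' : F <= F'.
  apply: ler_sum => u uC; case: ifP => uI; case: ifP => uI' //.
    case uT: (u \in T); first by rewrite inS // ltW.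
    apply: le_trans (submodular_marginal S T u ST _) _; first by rewrite uT.
    apply: wmax => //; rewrite inE (subsetP CA) // andbT.
    by apply: contraFN uT => /(subsetP ST).
  by move/negP: uI; case; apply: down uI'; apply: setUS; exact: subsetUr.
have d'd : 0 <= d - d' by rewrite subr_ge0 dP.
(* Raising the charge from [d'] back to [d] costs at most [k * #|S| * (d - d')]. Added to the
   [k * (1 + #|S|) * d'] of the induction hypothesis this gives [k * d' + k * #|S| * d], and [d'] is
   the gain of adding [w]. *)
have := blocked_sum_le C S (d - d') CI SI d'd.
have -> : \sum_(u in C) (if (u |: S)%SET \in I then f (u |: T)%SET - f T else d)
   = F + \sum_(u in C) (if (u |: S)%SET \in I then 0 else d - d').
  by rewrite -big_split /=; apply: eq_bigr => u _; case: ifP => _; ring.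
move=> le2; move: F'le FF' le2; rewrite natrD /d'.
move: (\sum_(u in C) _) => G; move: (#|S|%:R) => s; lra.
Qed.

Lemma greedy_result A : let T := result o (greedy R tie A) in
  T \in I /\ T \subset A.
Proof.
by have [] := greedy_loop_result A #|A| _ k_system_set0 (sub0set A).
Qed.

Lemma greedy_approx A C : C \in I -> C \subset A ->
  f (result o (greedy R tie A) :|: C)%SET <=
    (k + 1) * f (result o (greedy R tie A)).
Proof.
move=> CI CA; have [_ down] := sysI.1.
(* Any nonnegative upper bound on the initial marginals serves: its coefficient [k * #|S|] is 0 at
   the empty start. *)
pose d := \sum_(X : {set N}) f X.
have d_ge0 : 0 <= d by apply: sumr_ge0.
have dP u : u \in (A :\: finset.set0)%SET -> (u |: finset.set0)%SET \in I ->
    f (u |: finset.set0)%SET - f finset.set0 <= d.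
  move=> _ _; rewrite /d (bigD1 (u |: finset.set0)%SET) //= lerD2l.
  by apply: (@le_trans _ _ 0); [rewrite oppr_le0|apply: sumr_ge0].
have fuelA : (#|A| <= #|A| + #|finset.set0 : {set N}|)%N by rewrite leq_addr.
have := greedy_loop_gain C A #|A| _ d CI CA k_system_set0 (sub0set A) fuelA
  d_ge0 dP; rewrite -/(greedy R tie A).
move=> /=; set T := result _ _.
rewrite cards0 mulr0 mul0r addr0 => le1.
have le2 := submodular_sum_marginals T C.
have le3 : \sum_(u in C) (f (u |: T)%SET - f T) <= k * (f T - f finset.set0).
  apply: le_trans le1; apply: ler_sum => u uC; rewrite setU0.
  by rewrite (down _ C) ?sub1set.
have : 0 <= k * f finset.set0 by rewrite mulr_ge0 // (le_trans ler01).
lra.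
Qed.

(** * Repeated rounds, with greedy and USM solutions combined *)

Section Repeated.
Variables (alpha : R) (usm : usm_algorithm R).
Hypotheses (alpha_gt0 : 0 < alpha) (usm_apx : usm_approximation alpha usm).

Lemma usm_sub S : result f (usm N S) \subset S.
Proof. by have [] := usm_apx N f S f_ge0 f_sub. Qed.

Lemma usm_ge S B : B \subset S -> f B <= alpha * f (result f (usm N S)).
Proof.
have [_ apx /apx] := usm_apx N f S f_ge0 f_sub.
by rewrite mulrC ler_pdivrMr // mulrC.
Qed.

Lemma result_candidatesS l A : let S := result o (greedy R tie A) in
  result o (candidates usm tie l.+1 A) =
  S :: result f (usm N S) :: result o (candidates usm tie l (A :\: S)%SET).
Proof. by rewrite /= !result_bind result_lift_value. Qed.

Lemma candidates_indep l A X :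
  X \in result o (candidates usm tie l A) -> X \in I.
Proof.
have [_ down] := sysI.1.
elim: l A => [//|l IH] A; rewrite result_candidatesS.
have [SI _] := greedy_result A.
rewrite !inE => /or3P[/eqP->//|/eqP->|/IH//].
by apply: down SI; exact: usm_sub.
Qed.

Lemma size_candidates l A : size (result o (candidates usm tie l A)) = l.*2.
Proof. by elim: l A => // l IH A; rewrite result_candidatesS /= IH. Qed.

Lemma candidates_calls (c : R) l A :
  (forall B, (calls f (usm N B))%:R <= c) ->
  (calls o (candidates usm tie l A))%:R <=
    l%:R * (((rank I + 1) * (1 + 2 * #|N|))%N%:R + c).
Proof.
move=> usm_c; elim: l A => [|l IH] A; first by rewrite mul0r.
rewrite /= !calls_bind calls_lift_value /= addn0 !natrD.
set S := result _ _; have := IH (A :\: S)%SET; have := usm_c S.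
have := greedy_loop_calls A #|A| _ k_system_set0; rewrite cards0 subn0.
rewrite -/(greedy R tie A) -(ler_nat R) -[l.+1%:R]natr1.
lra.
Qed.

(* [W] collects the greedy solutions of the earlier rounds.  Submodularity makes
   the terms [f (W :|: O)] telescope, because consecutive rounds pick disjoint
   sets, and the part of [O] lost to [W] is paid for by the USM solutions. *)
Lemma candidates_bound (O : {set N}) (M : R) l W : O \in I ->
  (forall X, X \in result o (candidates usm tie l (~: W)%SET) -> f X <= M) ->
  l%:R * f O <= f (W :|: O)%SET + l%:R * ((k + 1) * M) +
    l%:R * (f (O :&: W)%SET - f finset.set0) +
    alpha * M * (l%:R * (l%:R - 1) / 2).
Proof.
move=> OI; have [_ down] := sysI.1.
elim: l W => [|l IH] W; first by move=> _; have := f_ge0 (W :|: O)%SET; lra.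
rewrite result_candidatesS; have [SI SW] := greedy_result (~: W)%SET.
have := greedy_approx (~: W)%SET (O :\: W)%SET.
set S := result o _ in SI SW * => apx leM.
have fSM : f S <= M by apply: leM; rewrite mem_head.
have fUM : f (result f (usm N S)) <= M by apply: leM; rewrite !inE eqxx orbT.
have leM' X : X \in result o (candidates usm tie l (~: W :\: S)%SET) -> f X <= M.
  by move=> XS; apply: leM; rewrite !inE XS !orbT.
have {}apx : f (S :|: O :\: W)%SET <= (k + 1) * M.
  apply: le_trans (apx _ _) _; first by apply: down OI; exact: subsetDl.
    by rewrite setDE subsetIr.
  by apply: ler_wpM2l fSM; rewrite addr_ge0 // (le_trans ler01).
have SnW x : ~~ ((x \in S) && (x \in W)).
  by apply/andP => -[/(subsetP SW)]; rewrite inE => /negP.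
(* The next three inequalities are submodularity for explicit unions and intersections, computed
   from the disjointness of [S] and [W]. *)
have sub2 X Y A B : (X :|: Y)%SET = A -> (X :&: Y)%SET = B ->
    f A + f B <= f X + f Y by move=> <- <-.
have subSO : f (S :|: O)%SET + f finset.set0 <=
    f (S :|: O :\: W)%SET + f (O :&: W)%SET.
  by apply: sub2; apply/setP => x; rewrite !inE; move: (SnW x);
    do 3?[case: (x \in _)].
have subWO : f (W :|: S :|: O)%SET + f O <= f (W :|: O)%SET + f (S :|: O)%SET.
  by apply: sub2; apply/setP => x; rewrite !inE; move: (SnW x);
    do 3?[case: (x \in _)].
have subOW : f (O :&: (W :|: S))%SET + f finset.set0 <=
    f (O :&: W)%SET + f (O :&: S)%SET.
  by apply: sub2; apply/setP => x; rewrite !inE; move: (SnW x);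
    do 3?[case: (x \in _)].
have OSM : f (O :&: S)%SET <= alpha * M.
  apply: le_trans (usm_ge S _ (subsetIr _ _)) _.
  by rewrite ler_pM2l.
have := IH (W :|: S)%SET; rewrite setCU -setDE => /(_ leM') le1.
(* Each of the [l] later rounds pays [alpha * M] for the elements of [O] taken by [S], which raises
   [l * (l - 1) / 2] to [(l + 1) * l / 2]. *)
have le2 : l%:R * (f (O :&: (W :|: S))%SET - f finset.set0) <=
    l%:R * (f (O :&: W)%SET - f finset.set0 + (alpha * M - f finset.set0)).
  by apply: ler_wpM2l => //; lra.
have le3 : 0 <= l%:R * f finset.set0 by rewrite mulr_ge0.
have := f_ge0 finset.set0; rewrite -[l.+1%:R]natr1; lra.
Qed.

Variable out : tie_rule {set N}.

Lemma repeated_greedy_calls l :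
  calls o (repeated_greedy usm tie out l) =
  (calls o (candidates usm tie l [set: N]%SET) + l.*2)%N.
Proof.
rewrite /repeated_greedy !calls_bind calls_with_values size_candidates.
by case: argmaxes => //= *; rewrite addn0.
Qed.

Lemma repeated_greedyP l : (0 < l)%N ->
  let S := result o (repeated_greedy usm tie out l) in
  S \in result o (candidates usm tie l [set: N]%SET) /\
  forall X, X \in result o (candidates usm tie l [set: N]%SET) -> f X <= f S.
Proof.
move=> l_gt0; rewrite /repeated_greedy !result_bind result_with_values.
set Ss := result o (candidates _ _ _ _).
case E: (argmaxes [seq (Y, f Y) | Y <- Ss]) => [|X Xs].
  have := argmaxes_eq0 _ E; have := size_candidates l [set: N]%SET.
  by rewrite -/Ss; case: Ss {E} => //; case: l l_gt0.
have : out X Xs \in argmaxes [seq (Y, f Y) | Y <- Ss].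
  by rewrite E; exact: tie_pickP.
move=> /mem_argmaxes[v [/mapP[Y YSs [/= -> ->]] vmax]].
by split => // Z ZSs; apply: (vmax (Z, f Z)); exact: map_f.
Qed.

Lemma repeated_greedy_indep l :
  result o (repeated_greedy usm tie out l) \in I.
Proof.
case: l => [|l]; last exact: candidates_indep (repeated_greedyP _ _).1.
by rewrite /repeated_greedy /=; exact: k_system_set0.
Qed.

(** The case of an empty [W]: the term [f (W :|: O)] is then [f O], and moving it to the left turns
    [l] into [l - 1]. *)
Lemma repeated_greedy_approx l O : (0 < l)%N -> O \in I ->
  (l%:R - 1) * f O <=
    (l%:R * (k + 1) + alpha * (l%:R * (l%:R - 1) / 2)) *
    f (result o (repeated_greedy usm tie out l)).
Proof.
move=> l_gt0 OI; have [_ Smax] := repeated_greedyP l l_gt0.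
have := candidates_bound O _ l finset.set0 OI; rewrite setC0 => /(_ _ Smax).
rewrite set0U setI0; lra.
Qed.

(** Monotonicity bounds [f O] by the value of [O] joined to the first greedy solution, to which the
    greedy guarantee applies on the whole ground set. *)
Lemma repeated_greedy_monotone_approx O : monotone_setfun f -> O \in I ->
  f O <= (k + 1) * f (result o (repeated_greedy usm tie out 1)).
Proof.
move=> f_mono OI; have [_ Smax] := repeated_greedyP 1 isT.
apply: le_trans (f_mono _ _ (subsetUr (result o (greedy R tie [set: N]%SET)) O)) _.
apply: le_trans (greedy_approx _ _ OI (subsetT _)) _.
rewrite ler_pM2l; last by rewrite ltr_wpDl // (le_trans ler01).
by apply: Smax; rewrite result_candidatesS mem_head.
Qed.

End Repeated.
End Approximation.
End Greedy.
End Oracles.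

(** * Real estimates for the number of rounds and the vanishing term *)

Lemma rank_le_card {N : finType} (I : {set {set N}}) : (rank I <= #|N|)%N.
Proof. by apply/bigmax_leqP => S _; exact: max_card. Qed.

Lemma sqrt_succ_sub_sqrt_cvg0 {R : realType} (s : R) : 0 < s ->
  s * (Num.sqrt (k + 1) - Num.sqrt k) @[k --> +oo] --> (0 : R).
Proof.
move=> s_gt0; apply/cvgrPdist_lt => e e_gt0; near=> k.
have k_ge0 : 0 <= k by near: k; apply: nbhs_pinfty_ge; exact: num_real.
(* This threshold gives [e / s * sqrt k >= 1], so the square of [sqrt k + e / s] exceeds [k + 1]. *)
have k_big : (s / e) ^+ 2 <= k.
  by near: k; apply: nbhs_pinfty_ge; exact: num_real.
have d_gt0 : 0 < e / s by rewrite divr_gt0.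
have y_ge : s / e <= Num.sqrt k.
  by rewrite -(ler_sqrt _ k_ge0) sqrtr_sqr ger0_norm // divr_ge0 ?ltW in k_big.
have dy : 1 <= e / s * Num.sqrt k.
  apply: le_trans (ler_wpM2l (ltW d_gt0) y_ge).
  by rewrite mulrA divfK ?gt_eqF // divff ?gt_eqF.
have mono : Num.sqrt k <= Num.sqrt (k + 1).
  by apply: ler_wsqrtr; rewrite lerDl.
have lt_z : Num.sqrt (k + 1) < Num.sqrt k + e / s.
  rewrite -ltr_sqr ?nnegrE ?sqrtr_ge0 ?addr_ge0 ?sqrtr_ge0 ?(ltW d_gt0) //.
  rewrite sqr_sqrtr ?addr_ge0 // sqrrD sqr_sqrtr //.
  have : 0 < (e / s) ^+ 2 by rewrite exprn_gt0.
  lra.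
rewrite sub0r normrN ger0_norm ?mulr_ge0 ?subr_ge0 ?(ltW s_gt0) //.
by rewrite -ltr_pdivlMl // mulrC ltrBlDl.
Unshelve. all: by end_near. Qed.

Lemma ell_itv {R : realType} (alpha k : R) :
  (ell alpha k)%:R <= 1 + Num.sqrt (2 * (k + 1) / alpha) < (ell alpha k).+1%:R.
Proof. by apply: truncn_itv; rewrite addr_ge0 ?sqrtr_ge0. Qed.

(** For [k >= 1], both [1 <= sqrt k] and [k + 1 <= 2 * k]; the latter yields the constant 4. *)
Lemma ell_le_sqrt {R : realType} (alpha k : R) : 0 < alpha -> 1 <= k ->
  (ell alpha k)%:R <= (1 + Num.sqrt (4 / alpha)) * Num.sqrt k.
Proof.
move=> a_gt0 k_ge1; have /andP[/le_trans + _] := ell_itv alpha k; apply.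
rewrite [leRHS]mulrDl mul1r; apply: lerD.
  by rewrite -[leLHS]sqrtr1 ler_wsqrtr.
rewrite -sqrtrM ?divr_ge0 ?(ltW a_gt0) //; apply: ler_wsqrtr.
rewrite [leRHS]mulrAC ler_pM2r ?invr_gt0 //; lra.
Qed.

(* With [m = ell - 1 >= 1] and [x = sqrt (2 (k + 1) / alpha)], the claim reduces
   to [(x - m) ^ 2 <= m], which holds because [m <= x < m + 1]. *)
Lemma ell_ratio {R : realType} (alpha k : R) (l := (ell alpha k)%:R : R) :
  0 < alpha -> 1 <= k -> (1 < ell alpha k)%N ->
  l * (k + 1) + alpha * (l * (l - 1) / 2) <=
    (l - 1) * (k + Num.sqrt (2 * alpha) * Num.sqrt k + (alpha + 1) +
      Num.sqrt (2 * alpha) * (Num.sqrt (k + 1) - Num.sqrt k)).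
Proof.
move=> a_gt0 k_ge1 l_gt1; have := ell_itv alpha k; rewrite -natr1 -/l.
have : 2 <= l by rewrite ler_nat.
set x := Num.sqrt (2 * (k + 1) / alpha) => l_ge2 /andP[lx xl].
have k1_ge0 : 0 <= k + 1 by lra.
have x_ge0 : 0 <= x by rewrite sqrtr_ge0.
have xE : alpha * x ^+ 2 = 2 * (k + 1).
  rewrite sqr_sqrtr; last by rewrite divr_ge0 ?mulr_ge0 ?(ltW a_gt0).
  by rewrite mulrC divfK ?gt_eqF.
(* The error term replaces [sqrt k] by [sqrt (k + 1)], and [sqrt (2 * alpha) * sqrt (k + 1)] is
   [alpha * x]. *)
have -> : k + Num.sqrt (2 * alpha) * Num.sqrt k + (alpha + 1) +
      Num.sqrt (2 * alpha) * (Num.sqrt (k + 1) - Num.sqrt k) =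
    k + 1 + alpha + Num.sqrt (2 * alpha) * Num.sqrt (k + 1) by ring.
have -> : Num.sqrt (2 * alpha) * Num.sqrt (k + 1) = alpha * x.
  rewrite -sqrtrM ?mulr_ge0 ?(ltW a_gt0) //.
  rewrite (_ : 2 * alpha * (k + 1) = (alpha * x) ^+ 2).
    by rewrite sqrtr_sqr ger0_norm // mulr_ge0 ?(ltW a_gt0).
  by rewrite exprMn expr2 -[RHS]mulrA xE; ring.
have -> : k + 1 = alpha * x ^+ 2 / 2 by rewrite xE; field.
rewrite -subr_ge0.
rewrite (_ : _ - _ = alpha * (l - 1 - (x - (l - 1)) ^+ 2) / 2); last by field.
rewrite divr_ge0 ?mulr_ge0 ?(ltW a_gt0) // subr_ge0; nra.
Qed.

Theorem theorem28 (R : realType) (alpha : R) (usm : usm_algorithm R)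
    (alpha_gt0 : 0 < alpha)
    (usm_apx : usm_approximation alpha usm)
    (usm_lin : usm_linear_calls usm) :
  exists (C : R) (eps : R -> R),
    eps k @[k --> +oo] --> (0 : R) /\
    forall (N : finType) (I : {set {set N}}) (f : {set N} -> R) (k : R)
        (tie : {set N} -> {set N} -> tie_rule N) (out : tie_rule {set N}),
      1 <= k -> k_system k I -> nonneg_setfun f -> submodular_setfun f ->
      let RG := repeated_greedy usm tie out in
      let S := fun l => result (oracles f I) (RG l) in
      [/\ (0 < rank I)%N ->
            (calls (oracles f I) (RG (ell alpha k)))%:R
              <= C * (Num.sqrt k * (rank I)%:R * #|N|%:R),
          S (ell alpha k) \in I,
          (1 < ell alpha k)%N ->
            approx_ratio_at_most f I (S (ell alpha k))
              (k + Num.sqrt (2 * alpha) * Num.sqrt k + (alpha + 1) + eps k)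
        & monotone_setfun f ->
            S 1%N \in I /\ approx_ratio_at_most f I (S 1%N) (k + 1)].
Proof.
have [c cP] := usm_lin.
(* [C] multiplies the factor bounding the number of rounds by a bound on the cost per round; the
   error is the gap between [sqrt (k + 1)] and [sqrt k] in the ratio. *)
exists ((1 + Num.sqrt (4 / alpha)) * (8 + `|c|)).
exists (fun k => Num.sqrt (2 * alpha) * (Num.sqrt (k + 1) - Num.sqrt k)).
split; first by apply: sqrt_succ_sub_sqrt_cvg0; rewrite sqrtr_gt0 mulr_gt0.
move=> N I f k tie out k_ge1 sysI f_ge0 f_sub RG S.
have indS l : S l \in I.
  exact: repeated_greedy_indep sysI f_ge0 f_sub _ _ usm_apx _ _.
split => //.
- move=> r_gt0; have n_gt0 := leq_trans r_gt0 (rank_le_card I).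
  have := ell_le_sqrt alpha k alpha_gt0 k_ge1.
  set l := ell alpha k => lP.
  have usmP B : (calls f (usm N B))%:R <= `|c| * #|N|%:R.
    apply: le_trans (cP N f B f_ge0 f_sub n_gt0) _.
    by rewrite ler_wpM2r // ler_norm.
  have cands := candidates_calls _ _ _ f tie k sysI usm _ l [set: N]%SET usmP.
  rewrite repeated_greedy_calls natrD -muln2 natrM.
  have r_ge1 : 1 <= (rank I)%:R :> R by rewrite ler1n.
  have n_ge1 : 1 <= #|N|%:R :> R by rewrite ler1n.
  move: cands; rewrite natrM !natrD.
  move: r_ge1 n_ge1; set r := (rank I)%:R; set n := #|N|%:R => r_ge1 n_ge1 cands.
  have rn_ge1 : 1 <= r * n by rewrite mulr_ege1.
  have rn_ger : r <= r * n by rewrite ler_peMr // (le_trans ler01).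
  have rn_gen : n <= r * n by rewrite ler_peMl // (le_trans ler01).
  have crn : `|c| * n <= `|c| * (r * n) by rewrite ler_wpM2l.
  (* The summand 2 pays for evaluating the two candidates of a round; as [r] and [n] are at least 1,
     [2 * r * n + r + 2 * n + 3 <= 8 * r * n]. *)
  have round : (r + 1) * (1 + 2 * n) + `|c| * n + 2 <= (8 + `|c|) * (r * n).
    by lra.
  have l_ge0 : 0 <= l%:R :> R by [].
  have := ler_wpM2l l_ge0 round.
  have rest_ge0 : 0 <= (8 + `|c|) * (r * n).
    by rewrite mulr_ge0 ?addr_ge0 // (le_trans ler01).
  have := ler_wpM2r rest_ge0 lP.
  move: cands; move: (Num.sqrt k) (Num.sqrt _) (calls _ _)%:R => a b d; lra.
- move=> l_gt1.
  have := ell_ratio alpha k alpha_gt0 k_ge1 l_gt1.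
  set a := k + _ + _ + _ => ratio.
  have l1_gt0 : 0 < (ell alpha k)%:R - 1 :> R by rewrite subr_gt0 ltr1n.
  have a_gt0 : 0 < a.
    rewrite /a; have : 0 <= Num.sqrt (2 * alpha) * Num.sqrt k.
      by rewrite mulr_ge0 ?sqrtr_ge0.
    have : 0 <= Num.sqrt (2 * alpha) * (Num.sqrt (k + 1) - Num.sqrt k).
      by rewrite mulr_ge0 ?sqrtr_ge0 // subr_ge0 ler_wsqrtr // lerDl.
    lra.
  split => // O [OI _]; rewrite ler_pdivrMr // mulrC -(ler_pM2l l1_gt0) mulrA.
  apply: le_trans (ler_wpM2r (f_ge0 _) ratio).
  exact: repeated_greedy_approx k_ge1 sysI f_ge0 f_sub _ _ alpha_gt0 usm_apx
    _ _ _ (ltnW l_gt1) OI.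
- move=> f_mono; split => //; have k1_gt0 : 0 < k + 1 by lra.
  split => // O [OI _]; rewrite ler_pdivrMr // mulrC.
  exact: repeated_greedy_monotone_approx.
Qed.
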